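(* Let $0<\lambda\le 1$, let $X=\prod_{k\ge 1}\{0,1\}$ and let $\nu_\lambda=\otimes_{k\ge1}\nu_{\lambda,k}$ be the Bernoulli measure on $X$ with $\nu_{\lambda,k}(0)=\frac{1}{1+\lambda}$ and $\nu_{\lambda,k}(1)=\frac{\lambda}{1+\lambda}$ for all $k\ge 1$. Then the natural action of $S_\infty$ on $(X,\nu_\lambda)$ is approximately transitive (AT).
   Context: $S_\infty=\bigcup_{k\ge1}S_k$ is the group of finite permutations of $\mathbb{N}=\{1,2,3,\dots\}$ (permutations moving only finitely many integers). The natural action of $S_\infty$ on $X=\prod_{k\ge1}\{0,1\}$ (with the product $\sigma$-algebra) associates to $\sigma\in S_\infty$ the automorphism, also denoted $\sigma$, given by $\sigma(x_1,x_2,x_3,\dots)=(x_{\sigma(1)},x_{\sigma(2)},x_{\sigma(3)},\dots)$. Approximate transitivity: an action $\alpha$ of a Borel group $G$ by non-singular automorphisms of a Lebesgue measure space $(Y,\nu)$ is approximately transitive (AT) if for every $n<\infty$, all $f_1,\dots,f_n\in L^1_+(Y,\nu)$ (nonnegative integrable functions) and every $\varepsilon>0$, there exist $f\in L^1_+(Y,\nu)$, finitely many elements $g_1,\dots,g_m\in G$, and reals $\lambda_{j,k}\ge 0$ ($1\le j\le n$, $1\le k\le m$) such that $$\Big\|f_j-\sum_{k=1}^m\lambda_{j,k}\,\beta_{g_k}(f)\Big\|\le\varepsilon,\qquad j=1,\dots,n,$$ where $\|\cdot\|$ is the $L^1(Y,\nu)$ norm and $\beta_g(f)(y)=f(\alpha_g^{-1}y)\,\frac{d(\nu\circ\alpha_g^{-1})}{d\nu}(y)$,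 with $(\nu\circ\alpha_g^{-1})(A)=\nu(\alpha_g^{-1}A)$. (Only the family of automorphisms $\{\alpha_g\}$ matters in this definition.) *)

(* Defs.v *)
From HB Require Import structures.
From mathcomp Require Import all_boot all_order all_algebra.
From mathcomp Require Import all_classical all_reals all_analysis.
From mathcomp Require Import measurable_realfun ring lra.

Set Implicit Arguments.
Unset Strict Implicit.
Unset Printing Implicit Defensive.

Import Order.TTheory GRing.Theory Num.Theory.
Import numFieldNormedType.Exports.

Local Open Scope classical_set_scope.
Local Open Scope ring_scope.

(* Coordinates are indexed from 0: the k-th coordinate here is x_(k+1) in the
   usual numbering by {1, 2, 3, ...}; [false] and [true] stand for 0 and 1. *)

Definition coordinate_events : set (set (nat -> bool)) :=
  \bigcup_k preimage_set_system setT (fun x : nat -> bool => x k) measurable.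

(* The space {0,1}^N with its product sigma-algebra. *)
Definition binseq := g_sigma_algebraType coordinate_events.

Lemma measurable_coordinate k :
  measurable_fun setT (fun x : binseq => x k).
Proof.
move=> _ B mB; apply: sub_sigma_algebra; exists k => //=.
by exists B.
Qed.

Lemma measurable_to_binseq d (T : measurableType d) (f : T -> binseq) :
  (forall k, measurable_fun setT (fun t => f t k)) -> measurable_fun setT f.
Proof.
move=> mf; apply: (@measurability _ _ _ binseq setT f coordinate_events) => //.
move=> _ [_ [k _ [B mB <-]] <-].
have := mf k measurableT B mB.
by rewrite !setTI.
Qed.

(* Determines [nu] uniquely, since the measurable rectangles form a
   pi-system generating the product sigma-algebra. *)
Definition is_product_probability (R : realType)
    (mu : nat -> probability bool R) (nu : probability binseq R) : Prop :=
  forall (n : nat) (A : nat -> set bool),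
    nu [set x | forall k, (k < n)%N -> A k (x k)] =
    (\prod_(k < n) mu k (A k))%E.

(* [bernoulli_prob p] gives mass p to [true]; the two masses are computed in
   [bernoulli_factor_true] and [bernoulli_factor_false]. *)
Definition is_bernoulli_measure (R : realType) (lambda : R)
    (nu : probability binseq R) : Prop :=
  is_product_probability (fun=> bernoulli_prob (lambda / (1 + lambda))) nu.

Section bernoulli_factor.
Context (R : realType) (lambda : R).
Hypothesis lambda_gt0 : 0 < lambda.

Lemma bernoulli_factor_bounds : 0 < lambda / (1 + lambda) < 1.
Proof.
have h : 0 < 1 + lambda by rewrite addr_gt0.
by rewrite divr_gt0//= ltr_pdivrMr// mul1r ltrDr.
Qed.

Lemma bernoulli_factor_true :
  bernoulli_prob (lambda / (1 + lambda)) [set true] =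
  (lambda / (1 + lambda))%:E.
Proof.
have /andP[/ltW p0 /ltW p1] := bernoulli_factor_bounds.
rewrite bernoulli_probE ?p0//= /dirac/= !indicE.
by rewrite mem_set// memNset//= mule1 mule0 adde0.
Qed.

Lemma bernoulli_factor_false :
  bernoulli_prob (lambda / (1 + lambda)) [set false] = (1 / (1 + lambda))%:E.
Proof.
have /andP[/ltW p0 /ltW p1] := bernoulli_factor_bounds.
rewrite bernoulli_probE ?p0//= /dirac/= !indicE.
rewrite memNset// mem_set//= mule1 mule0 add0e; congr (_%:E).
by rewrite /unstable.onem; field; rewrite gt_eqF// addr_gt0.
Qed.

End bernoulli_factor.

(* Existence of Bernoulli measures: the law, under Lebesgue measure on [0, 1[,
   of the itinerary of a point under the p-adapted doubling map. *)
Section bernoulli_measure_exists.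
Context (R : realType) (p : R).

Let step (t : R) : R := if t < p then t / p else (t - p) / (1 - p).
Let code (t : R) : binseq := fun k => iter k step t < p.
Let mI : measurable (`[0, 1[ : set R) := measurable_itv _.

Let measurable_step : measurable_fun setT step.
Proof.
apply: measurable_fun_ifT => //=.
- exact: measurable_fun_ltr.
- exact: measurable_funM.
- by apply: measurable_funM => //; exact: measurable_funB.
Qed.

Let measurable_code : measurable_fun setT code.
Proof.
apply: measurable_to_binseq => k; apply: measurable_fun_ltr => //.
elim: k => [|k IH] /=; first exact: measurable_id.
exact: measurableT_comp IH.
Qed.

Hypothesis p01 : 0 < p < 1.

Let code_rectangle n : forall (A : nat -> set bool) (a c : R), 0 < c ->
  let E := [set t | (t \in `[a, a + c[) /\
                    forall k, (k < n)%N -> A k (code ((t - a) / c) k)] in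
  measurable E /\
  lebesgue_measure E = (c%:E * \prod_(k < n) bernoulli_prob p (A k))%E.
Proof.
have /andP[p0 p1] := p01.
elim: n => [|n IH] A a c c0 E.
  have -> : E = [set` `[a, (a + c)%R[ ].
    by apply/seteqP; split => t /=; [case|].
  split => //; rewrite big_ord0 mule1 lebesgue_measure_itv/= lte_fin ltrDl c0.
  by rewrite -EFinB addrAC subrr add0r.
have cp0 : 0 < c * p by exact: mulr_gt0.
have cq0 : 0 < c * (1 - p) by rewrite mulr_gt0// subr_gt0.
pose F a c := [set t | (t \in `[a, a + c[) /\
  forall k, (k < n)%N -> A k.+1 (code ((t - a) / c) k)].
have [mE1 E1E] := IH (A \o succn) a _ cp0.
have [mE2 E2E] := IH (A \o succn) (a + c * p) _ cq0.
rewrite -/(F _ _) in mE1 E1E; rewrite -/(F _ _) in mE2 E2E.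
set E1 := F a (c * p) in mE1 E1E.
set E2 := F (a + c * p) (c * (1 - p)) in mE2 E2E.
pose D b : set R := [set _ | A 0 b].
have mD b : measurable (D b).
  have [Ab|Ab] := pselect (A 0 b).
    by rewrite (_ : D b = setT)// -subTset => ?.
  by rewrite (_ : D b = set0)// -subset0 => ?.
have cc : a + c * p + c * (1 - p) = a + c by ring.
have EE : E = (D true `&` E1) `|` (D false `&` E2).
  have digit0 t : code t 0 = (t < p) by [].
  have digitS t k : code t k.+1 = code (step t) k by rewrite /code iterSr.
  have Elt t : (t - a) / c < p = (t < a + c * p).
    by rewrite ltr_pdivrMr// ltrBlDl mulrC.
  have step1 t : t < a + c * p -> step ((t - a) / c) = (t - a) / (c * p).
    by rewrite /step Elt => ->; field; lra.
  have step2 t : (t < a + c * p) = false ->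
      step ((t - a) / c) = (t - (a + c * p)) / (c * (1 - p)).
    by rewrite /step Elt => ->; field; lra.
  apply/seteqP; split => t.
    move=> [tac At].
    have := At 0 erefl; rewrite digit0 Elt.
    case: (boolP (t < a + c * p)) => tlt tD; [left|right]; split => //; split.
    - by move: tac; rewrite !in_itv/= => /andP[-> _].
    - by move=> k kn /=; rewrite -step1// -digitS; exact: At.
    - move: tac; rewrite !in_itv/= cc => /andP[_ ->].
      by rewrite leNgt tlt.
    - move=> k kn /=; rewrite -step2; last exact/negbTE.
      by rewrite -digitS; exact: At.
  move=> [|] [Dt [tac At]]; split.
  - move: tac; rewrite !in_itv/= => /andP[-> /lt_trans]; apply.
    by rewrite ltrD2l; nra.
  - have tlt : t < a + c * p by move: tac; rewrite in_itv/= => /andP[].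
    case=> [_|k kn]; first by rewrite digit0 Elt tlt.
    by rewrite digitS step1//; exact: At.
  - move: tac; rewrite !in_itv/= cc => /andP[h ->]; rewrite andbT.
    by apply: le_trans h; rewrite lerDl ltW.
  - have tlt : (t < a + c * p) = false.
      by move: tac; rewrite in_itv/= => /andP[+ _]; rewrite leNgt => /negbTE.
    case=> [_|k kn]; first by rewrite digit0 Elt tlt.
    by rewrite digitS step2//; exact: At.
have mDE1 : measurable (D true `&` E1) by exact: measurableI.
have mDE2 : measurable (D false `&` E2) by exact: measurableI.
split; first by rewrite EE; exact: measurableU.
have muD b B : lebesgue_measure (D b `&` B) =
               (\d_b (A 0%N) * lebesgue_measure B)%E.
  rewrite diracE; case: (boolP (b \in A 0)) => [/set_mem Ab|/negP Ab] /=.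
    by rewrite mul1e (_ : D b = setT) ?setTI// -subTset => ?.
  rewrite mul0e (_ : D b = set0) ?set0I ?measure0// -subset0 => t Dt.
  by apply: Ab; rewrite inE.
rewrite EE measureU//; last first.
  rewrite -subset0 => t [[_ [+ _]] [_ [+ _]]].
  by rewrite !in_itv/= => /andP[_ +] /andP[+ _]; rewrite leNgt => ->.
rewrite [LHS](congr2 adde (muD true E1) (muD false E2)).
rewrite [in LHS]E1E [in LHS]E2E big_ord_recl/=.
rewrite [in RHS]bernoulli_probE; last by rewrite !ltW.
have : (\prod_(k < n) bernoulli_prob p ((A \o succn) k))%E \is a fin_num.
  elim/big_ind : _ => // [x y xf yf|i _]; first by rewrite fin_numM.
  exact: fin_num_measure.
rewrite /comp.
under [in RHS]eq_bigr do rewrite /bump leq0n add1n.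
move: (\prod_(k < n) _)%E => P /fineK <-.
rewrite -[adde _ _]/(_ + _)%E !diracE -?(EFinM, EFinD); congr EFin.
by rewrite /unstable.onem; ring.
Qed.

Lemma is_product_probability_bernoulli_exists :
  exists nu : probability binseq R,
    is_product_probability (fun=> bernoulli_prob p) nu.
Proof.
have mcode : measurable_fun setT (code : measurableTypeR R -> binseq).
  exact: measurable_code.
pose codem : {mfun measurableTypeR R >-> binseq} :=
  HB.pack (code : measurableTypeR R -> binseq)
    (isMeasurableFun.Build _ _ _ _ _ mcode).
pose U0 := [the {measure set (measurableTypeR R) -> \bar R} of
  mrestr lebesgue_measure mI].
have U0T : U0 setT = 1%E.
  by rewrite /U0/= /mrestr setTI lebesgue_measure_itv/= lte_fin ltr01 sube0.
pose U : probability (measurableTypeR R) R :=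
  HB.pack (mrestr lebesgue_measure mI) (Measure_isProbability.Build _ _ _ U0 U0T).
exists (distribution U codem) => n A.
have [_] := code_rectangle n A 0 ltr01; rewrite mul1e => <-.
rewrite /distribution /pushforward /= /mrestr; congr lebesgue_measure.
apply/seteqP; split => t /=; rewrite add0r subr0 divr1.
  by move=> [].
by move=> [].
Qed.

End bernoulli_measure_exists.

Lemma is_bernoulli_measure_exists (R : realType) (lambda : R) :
  0 < lambda ->
  exists nu : probability binseq R, is_bernoulli_measure lambda nu.
Proof.
by move=> /bernoulli_factor_bounds; exact: is_product_probability_bernoulli_exists.
Qed.

Record finperm := FinPerm {
  finperm_fun :> nat -> nat;
  finperm_inv : nat -> nat;
  finpermK : cancel finperm_fun finperm_inv;
  finperm_invK : cancel finperm_inv finperm_fun;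
  finperm_finite : finite_set [set k | finperm_fun k <> k] }.

HB.instance Definition _ := gen_eqMixin finperm.
HB.instance Definition _ := gen_choiceMixin finperm.

Lemma finpermP (s t : finperm) : s =1 t -> s = t.
Proof.
case: s t => [f f' fK f'K ff] [g g' gK g'K gf] /= /funext fg.
subst g; have fg' : f' = g'.
  by apply/funext => k; apply: (can_inj fK); rewrite f'K g'K.
by subst g'; congr FinPerm; exact: Prop_irrelevance.
Qed.

Section finperm_group.
Implicit Types s t : finperm.

Let finite_id : finite_set [set k : nat | id k <> k].
Proof. by rewrite (_ : [set _ | _] = set0)// -subset0 => k /=. Qed.

Definition finperm_one := @FinPerm id id (fun=> erefl) (fun=> erefl) finite_id.

Let finite_inv s : finite_set [set k | finperm_inv s k <> k].
Proof.
apply: sub_finite_set (finperm_finite s) => k /= sk h; apply: sk.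
by rewrite -{1}h finpermK.
Qed.

Definition finperm_invg s :=
  FinPerm (@finperm_invK s) (@finpermK s) (finite_inv s).

Let finite_mul s t : finite_set [set k | (t \o s) k <> k].
Proof.
apply: (@sub_finite_set _ _ ([set k | s k <> k] `|` [set k | t k <> k])).
  move=> k /= tsk; have [sk|] := pselect (s k = k); last by left.
  by right; rewrite sk in tsk.
by rewrite finite_setU; split; exact: finperm_finite.
Qed.

(* As for MathComp's {perm T}, (s * t) k = t (s k); with this convention
   x |-> x \o s is a left action. *)
Definition finperm_mul s t := FinPerm (can_comp (@finpermK t) (@finpermK s))
  (can_comp (@finperm_invK s) (@finperm_invK t)) (finite_mul s t).

Let mulA : associative finperm_mul.
Proof. by move=> s t u; apply: finpermP. Qed.
Let mul1 : left_id finperm_one finperm_mul.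
Proof. by move=> s; apply: finpermP. Qed.
Let mulr1 : right_id finperm_one finperm_mul.
Proof. by move=> s; apply: finpermP. Qed.
Let mulV : left_inverse finperm_one finperm_invg finperm_mul.
Proof. by move=> s; apply: finpermP => k /=; rewrite finperm_invK. Qed.
Let mulrV : right_inverse finperm_one finperm_invg finperm_mul.
Proof. by move=> s; apply: finpermP => k /=; rewrite finpermK. Qed.

HB.instance Definition _ :=
  isGroup.Build finperm mulA mul1 mulr1 mulV mulrV.

End finperm_group.

Definition permute (s : finperm) (x : binseq) : binseq := fun k => x (s k).

Lemma measurable_permute (s : finperm) : measurable_fun setT (permute s).
Proof.
by apply: measurable_to_binseq => k; exact: measurable_coordinate.
Qed.

HB.instance Definition _ (s : finperm) :=
  isMeasurableFun.Build _ _ _ _ (permute s) (measurable_permute s).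

Definition natural_action (s : finperm) : {mfun binseq >-> binseq} :=
  permute s.

Section approximate_transitivity.
Context d (Y : measurableType d) (R : realType) (nu : probability Y R).
Context (G : groupType) (alpha : G -> {mfun Y >-> Y}).

(* [distribution nu (alpha g)] is the image measure A |-> nu (alpha_g^-1 A). *)
(* Being bijective and bimeasurable comes for free from the action laws. *)
Definition nonsingular_action : Prop :=
  [/\ alpha 1%g =1 id,
      forall g h : G, alpha (g * h)%g =1 alpha g \o alpha h,
      forall g, distribution nu (alpha g) `<< nu &
      forall g, nu `<< distribution nu (alpha g)].

(* f (alpha_g^-1 y) * d(nu o alpha_g^-1)/dnu (y) *)
Definition transfer (g : G) (f : Y -> R) (y : Y) : \bar R :=
  ((f (alpha g^-1%g y))%:E *
   Radon_Nikodym (charge_of_finite_measure (distribution nu (alpha g))) nu y)%E.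

Definition L1plus (f : Y -> R) : Prop :=
  (forall y, 0 <= f y) /\ nu.-integrable setT (EFin \o f).

(* Approximate transitivity is a property of non-singular actions, so
   non-singularity is part of it. *)
Definition approximately_transitive : Prop :=
  nonsingular_action /\
  forall (n : nat) (f_ : 'I_n -> Y -> R) (eps : R),
    (forall j, L1plus (f_ j)) -> 0 < eps ->
    exists (f : Y -> R) (m : nat) (g : 'I_m -> G) (lam : 'I_n -> 'I_m -> R),
      [/\ L1plus f, forall j k, 0 <= lam j k &
          forall j, ('N[nu]_1[(fun y => (f_ j y)%:E -
            \sum_(k < m) (lam j k)%:E * transfer (g k) f y)] <= eps%:E)%E].

End approximate_transitivity.

(* Main.v *)
(* A product measure on {0,1}^N with identical factors is invariant under
   finite permutations, so the Radon-Nikodym cocycle is 1. Functions of finitely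
   many coordinates are dense in L^1, so it suffices to approximate, with one
   common f, the indicators of all cylinders [w] with w a word of length N.
   Take f = indicator of 0^N 1^N. Swapping the positions i and N + i whenever
   w_i = 1 turns it into the indicator of w followed by its complement; one may
   further move the second half to any later block of N coordinates. The
   indicators that a block carries the complement of w are independent of each
   other and equidistributed, so by the weak law of large numbers their
   normalised average over many blocks tends to 1 in L^1, and the corresponding
   combination of translates of f tends to the indicator of [w]. *)

Require Import Defs.
From mathcomp Require Import all_boot all_order all_algebra.
From mathcomp Require Import all_classical all_reals all_analysis.
From mathcomp Require Import measurable_realfun ring lra.
From mathcomp Require Import zify.

Set Implicit Arguments.
Unset Strict Implicit.
Unset Printing Implicit Defensive.

Import Order.TTheory GRing.Theory Num.Theory.

Local Open Scope ring_scope.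
Local Open Scope classical_set_scope.

(** * Cylinders over finite sets of coordinates and their probability *)

Section cylinders.
Implicit Types (s t : seq nat) (A : nat -> set bool).

(** The coordinates form an arbitrary list because a permutation need not preserve initial
    segments. *)
Definition cylinder s A : set binseq := [set x | forall k, k \in s -> A k (x k)].

Lemma cylinder_nil A : cylinder [::] A = setT.
Proof. by apply/seteqP; split. Qed.

Lemma cylinder_cat s t A : cylinder (s ++ t) A = cylinder s A `&` cylinder t A.
Proof.
apply/seteqP; split => [x h|x [hs ht] k].
  by split=> k ks; apply: h; rewrite mem_cat ks ?orbT.
by rewrite mem_cat => /orP[/hs|/ht].
Qed.

Lemma measurable_cylinder s A : measurable (cylinder s A).
Proof.
elim: s => [|k s IH]; first by rewrite cylinder_nil; exact: measurableT.
rewrite -cat1s cylinder_cat; apply: measurableI => //.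
have -> : cylinder [:: k] A = (fun x : binseq => x k) @^-1` A k.
  by apply/seteqP; split=> [x /(_ k (mem_head _ _))//|x h j]; rewrite inE => /eqP->.
by rewrite -[X in measurable X]setTI; exact: measurable_coordinate.
Qed.

(** The product formula is given on initial segments only, so each coordinate below a bound of [s]
    but outside [s] receives the full set, a factor 1. Uniqueness prevents a repeated coordinate
    from contributing twice to the product. *)
Lemma cylinder_prob (R : realType) (mu : nat -> probability bool R)
    (nu : probability binseq R) s A :
  is_product_probability mu nu -> uniq s ->
  nu (cylinder s A) = (\prod_(k <- s) mu k (A k))%E.
Proof.
move=> hnu us; pose n := (\max_(k <- s) k).+1.
have sn k : k \in s -> (k < n)%N by move=> ks; rewrite ltnS; exact: leq_bigmax_seq.
pose B k := if k \in s then A k else setT.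
have -> : cylinder s A = [set x | forall k, (k < n)%N -> B k (x k)].
  apply/seteqP; split => x h k; first by rewrite /B; case: ifPn => // /h.
  by move=> ks; have := h k (sn _ ks); rewrite /B ks.
rewrite hnu -(big_mkord xpredT (fun k => mu k (B k))) (bigID (mem s))/=.
rewrite [X in (_ * X)%E]big1 ?mule1; last first.
  by move=> k /negbTE ks; rewrite /B ks probability_setT.
rewrite -big_filter (perm_big s); last first.
  rewrite uniq_perm ?filter_uniq ?iota_uniq// => k.
  rewrite mem_filter mem_index_iota/=.
  by apply/andP/idP => [[]|ks] //; rewrite ks sn.
by apply: eq_big_seq => k ks; rewrite /B ks.
Qed.

End cylinders.

(** * Invariance of the product measure under finite permutations *)

Section exchangeability.
Context (R : realType) (mu : probability bool R) (nu : probability binseq R).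
Hypothesis hnu : is_product_probability (fun=> mu) nu.

(** Cylinders form a pi-system generating the sigma-algebra. A permutation only relabels the
    coordinates of a cylinder, and since the factors are identical the product does not change. *)
Lemma distribution_permute (s : finperm) (A : set binseq) :
  measurable A -> distribution nu (permute s) A = nu A.
Proof.
pose G := [set B : set binseq | exists t A, B = cylinder t A].
apply: (@measure_unique _ R binseq G (fun=> setT)) => //.
- apply/seteqP; split; last first.
    apply: smallest_sub; first exact: sigma_algebra_measurable.
    by move=> _ [t [B ->]]; exact: measurable_cylinder.
  apply: smallest_sub; first exact: smallest_sigma_algebra.
  move=> _ [k _ [B mB <-]]; apply: sub_sigma_algebra.
  exists [:: k], (fun=> B); apply/seteqP; split=> [x [_ h] j|x h].
    by rewrite inE => /eqP ->.
  by split=> //; apply: h (mem_head _ _).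
- move=> _ _ [t [B ->]] [u [C ->]].
  (* The two lists may overlap; each constraint is imposed only on the coordinates of its own
     list. *)
  pose D k := [set b | (k \in t -> B k b) /\ (k \in u -> C k b)].
  exists (t ++ u), D; apply/seteqP; split.
    by move=> x [ht hu] k _; split=> [/ht|/hu].
  move=> x h; split=> k kt; have [] := h k; rewrite ?mem_cat ?kt ?orbT//.
    by move=> + _; apply.
  by move=> _; apply.
- by exists [::], (fun=> setT); rewrite cylinder_nil.
- by rewrite bigcup_const.
- move=> _ [t0 [B0 ->]].
  have [t [B [ut ->]]] : exists t B, uniq t /\ cylinder t0 B0 = cylinder t B.
    exists (undup t0), B0; split; first exact: undup_uniq.
    by apply/seteqP; split => x h k; have := h k; rewrite mem_undup.
  (* The sequence [x \o s] satisfies [B k] at [k] exactly when [x] satisfies it at [s k]. *)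
  transitivity (nu (cylinder (map s t) (fun k => B (finperm_inv s k)))).
    rewrite /distribution /pushforward; congr (nu _).
    apply/seteqP; split => x h k.
      by move=> /mapP[j jt ->]; rewrite finpermK; exact: h.
    by move=> kt; have := h (s k); rewrite finpermK; apply; apply: map_f.
  transitivity (\prod_(k <- t) mu (B k))%E; last exact/esym/(cylinder_prob _ hnu).
  rewrite (cylinder_prob _ hnu) ?map_inj_uniq//; last exact: can_inj (finpermK s).
  by rewrite big_map; under eq_bigr do rewrite finpermK.
- by move=> _; exact: fin_num_fun_lty.
Qed.

End exchangeability.

(** * Extension of finite injections to finite permutations *)

Section finperm_extension.

Let swap_fun (a b k : nat) := if k == a then b else if k == b then a else k.

Let swap_funK a b : involutive (swap_fun a b).
Proof.
move=> k; rewrite /swap_fun.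
case: (eqVneq k a) => [->|ka]; first by rewrite eqxx; case: eqVneq.
case: (eqVneq k b) => [->|kb]; first by rewrite eqxx.
by rewrite (negbTE ka) (negbTE kb).
Qed.

Let swap_fun_finite a b : finite_set [set k | swap_fun a b k <> k].
Proof.
apply: (@sub_finite_set _ _ [set a; b]); last exact: finite_set2.
move=> k /=; rewrite /swap_fun; case: eqP => [->|_]; first by left.
by case: eqP => [->|//]; right.
Qed.

(** Induction on [n]: follow the permutation built for [n] by the transposition of [s n] and [h n].
    The earlier values [h i = s i] stay fixed, as they differ from [s n] by injectivity of [s] and
    from [h n] by injectivity of [h]. *)
Lemma finperm_extension (n : nat) (h : nat -> nat) :
  {in gtn n &, injective h} ->
  exists s : finperm, forall i, (i < n)%N -> s i = h i.
Proof.
elim: n => [|n IH] hinj; first by exists finperm_one.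
have [s sh] : exists s : finperm, forall i, (i < n)%N -> s i = h i.
  by apply: IH => i j ii ji; apply: hinj; rewrite !inE in ii ji *; exact: ltnW.
pose t := FinPerm (@swap_funK (s n) (h n)) (@swap_funK (s n) (h n))
  (@swap_fun_finite (s n) (h n)).
exists (finperm_mul s t) => i; rewrite ltnS leq_eqVlt => /predU1P[->|ilt].
  by rewrite /= /swap_fun eqxx.
rewrite /= /swap_fun (inj_eq (can_inj (finpermK s))) ltn_eqF// sh//.
case: eqP => // hin; suff : i = n by move=> iE; rewrite iE ltnn in ilt.
by apply: hinj => //; rewrite inE; lia.
Qed.

End finperm_extension.

(** The derivative and the constant 1 have the same integral over every measurable set. Together
    with invariance this makes the cocycle of the action trivial. *)
Lemma Radon_Nikodym_eq1 d (T : measurableType d) (R : realType)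
    (mu nu : {finite_measure set T -> \bar R}) :
  (forall A, measurable A -> nu A = mu A) ->
  ae_eq mu setT (Radon_Nikodym (charge_of_finite_measure nu) mu) (cst 1%E).
Proof.
move=> numu; have dom : charge_of_finite_measure nu `<< mu.
  by apply/null_content_dominatesP => A mA muA; rewrite -muA; exact: numu.
apply: integral_ae_eq => //; first exact: Radon_Nikodym_integrable.
move=> E _ mE; rewrite -Radon_Nikodym_integral// integral_cst// mul1e.
exact: numu.
Qed.

(** * A quantitative weak law in L^1 for pairwise independent events of equal probability *)

Section weak_law.
Context d (T : measurableType d) (R : realType) (P : probability T R).
Context (Y : nat -> set T) (q : R).
Hypothesis mY : forall l, measurable (Y l).
Hypothesis q0 : 0 < q.
Hypothesis PY : forall l, P (Y l) = q%:E.
Hypothesis PYY : forall l l', l != l' -> P (Y l `&` Y l') = (q * q)%:E.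

(** This is the product of the centred variables [q - \1_(Y l)] and [q - \1_(Y l')], expanded so
    that it can be integrated term by term. *)
Let cov l l' x : R :=
  q * q - q * \1_(Y l) x - q * \1_(Y l') x + \1_(Y l `&` Y l') x.

Let integral_indicr A : measurable A -> (\int[P]_x (\1_A x)%:E = P A)%E.
Proof. by move=> mA; rewrite integral_indic// setIT. Qed.

Let cov_integrable l l' : P.-integrable setT (EFin \o cov l l').
Proof.
have I A : measurable A -> P.-integrable setT (EFin \o (\1_A : T -> R)).
  by move=> mA; apply: integrable_indic.
have Iq A : measurable A -> P.-integrable setT (fun x => (q * \1_A x)%:E).
  move=> mA; under eq_fun do rewrite EFinM.
  by apply: integrableZl => //; exact: I.
rewrite /cov/= (_ : _ \o _ = fun x => ((q * q)%:E - (q * \1_(Y l) x)%:E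
   - (q * \1_(Y l') x)%:E + (\1_(Y l `&` Y l') x)%:E)%E)//.
apply: integrableD => //; last exact: I (measurableI _ _ _ _).
apply: integrableB => //; last exact: Iq.
apply: integrableB => //; last exact: Iq.
exact: finite_measure_integrable_cst.
Qed.

Let integral_cov l l' :
  (\int[P]_x (cov l l' x)%:E = (if l == l' then q - q * q else 0)%:E)%E.
Proof.
have I A : measurable A -> P.-integrable setT (EFin \o (\1_A : T -> R)).
  by move=> mA; apply: integrable_indic.
have Iq A : measurable A -> P.-integrable setT (fun x => (q * \1_A x)%:E).
  move=> mA; under eq_fun do rewrite EFinM.
  by apply: integrableZl => //; exact: I.
have Eq A : measurable A -> (\int[P]_x (q * \1_A x)%:E = q%:E * P A)%E.
  move=> mA; under eq_integral do rewrite EFinM.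
  by rewrite integralZl//; [rewrite integral_indicr|exact: I].
have Ic : P.-integrable setT (fun=> (q * q)%:E).
  exact: finite_measure_integrable_cst.
rewrite [LHS](_ : _ = \int[P]_x ((q * q)%:E - (q * \1_(Y l) x)%:E
   - (q * \1_(Y l') x)%:E + (\1_(Y l `&` Y l') x)%:E))%E//.
rewrite integralD//; first last.
- exact: I (measurableI _ _ _ _).
- by apply: integrableB => //; [apply: integrableB => //; exact: Iq|exact: Iq].
rewrite integralB//; first last.
- exact: Iq.
- by apply: integrableB => //; exact: Iq.
rewrite integralB//; last exact: Iq.
rewrite !Eq// integral_indicr; last exact: measurableI.
rewrite integral_cst// [X in (_ * X)%E](probability_setT P) mule1 !PY.
have [<-|ll'] := eqVneq l l'.
  by rewrite setIid PY -EFinM -!EFinB -EFinD; congr EFin; ring.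
by rewrite PYY// -EFinM -!EFinB -EFinD; congr EFin; ring.
Qed.

(** The empirical frequency of the events, normalised to have mean 1. *)
Let ratio m x : R := (m%:R * q)^-1 * \sum_(l < m) \1_(Y l) x.

Let ratio_sqr m x : (0 < m)%N ->
  (1 - ratio m x) ^+ 2 = (m%:R * q) ^- 2 * \sum_(l < m) \sum_(l' < m) cov l l' x.
Proof.
move=> m0; have mq0 : m%:R * q != 0 by rewrite mulf_neq0 ?pnatr_eq0 ?gt_eqF// -lt0n.
have -> : 1 - ratio m x = (m%:R * q)^-1 * \sum_(l < m) (q - \1_(Y l) x).
  by rewrite sumrB sumr_const card_ord -[q *+ m]mulr_natl mulrBr mulVf.
rewrite exprMn exprVn; congr (_ * _); rewrite expr2 mulr_suml.
apply: eq_bigr => l _; rewrite mulr_sumr; apply: eq_bigr => l' _.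
by rewrite /cov indicI /=; ring.
Qed.

Let integral_ratio_sqr m : (0 < m)%N ->
  (\int[P]_x ((1 - ratio m x) ^+ 2)%:E <= ((m%:R * q)^-1)%:E)%E.
Proof.
move=> m0; under eq_integral do rewrite ratio_sqr// EFinM -sumEFin.
have Isum l : P.-integrable setT (fun x => (\sum_(l' < m) cov l l' x)%:E).
  under eq_fun do rewrite -sumEFin.
  by apply: integrable_sum => // l' _; exact: cov_integrable.
rewrite integralZl//; last by apply: integrable_sum => // l _; exact: Isum.
rewrite integral_sum//.
under eq_bigr => l _.
  under eq_integral do rewrite -sumEFin.
  rewrite integral_sum//=; last by move=> l'; exact: cov_integrable.
  under eq_bigr do rewrite integral_cov.
  (* By pairwise independence only the diagonal term survives. *)
  rewrite sumEFin -big_mkcond (big_pred1 l); last by move=> i; rewrite eq_sym.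
  over.
rewrite sumEFin sumr_const card_ord -EFinM lee_fin.
have mR0 : 0 < m%:R :> R by rewrite ltr0n.
(* The variance is [m * (q - q * q)] divided by the square of [m * q], that is
   [(1 - q) / (m * q)]. *)
rewrite -[X in _ * X]mulr_natl (_ : _ * _ = (m%:R * q)^-1 * (1 - q)); last first.
  by field; rewrite !gt_eqF.
by rewrite ler_piMr ?invr_ge0 ?mulr_ge0 ?ltW// gtrBl.
Qed.

(** The parameter [e] stays free: a small [e] controls the first term, then a large [m] controls the
    second. *)
Lemma weak_law_L1 m (e : R) : (0 < m)%N -> 0 < e ->
  (\int[P]_x `|1 - (m%:R * q)^-1 * \sum_(l < m) \1_(Y l) x|%:E <=
   (e / 2 + (2 * e * m%:R * q)^-1)%:E)%E.
Proof.
move=> m0 e0.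
have mS : measurable_fun setT (ratio m).
  apply: measurable_funM => //; apply: measurable_sum => l.
  exact: measurable_indic.
have m1S : measurable_fun setT (fun x => 1 - ratio m x).
  exact: measurable_funB.
(* AM-GM: [`|a| <= e / 2 + a ^ 2 / (2 e)] *)
apply: (@le_trans _ _ (\int[P]_x ((e / 2)%:E + ((2 * e)^-1)%:E *
    ((1 - ratio m x) ^+ 2)%:E)))%E.
  apply: ge0_le_integral => //.
  - by apply/measurable_EFinP; exact: measurableT_comp.
  - apply: emeasurable_funD => //; apply: emeasurable_funM => //.
    by apply/measurable_EFinP; exact: measurable_funX.
  move=> x _; rewrite -EFinM -EFinD lee_fin.
  rewrite -/(ratio m x) -(real_normK (num_real (1 - _))).
  set a := `| _ |; rewrite -subr_ge0.
  have -> : e / 2 + (2 * e)^-1 * a ^+ 2 - a = (2 * e)^-1 * (a - e) ^+ 2.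
    by field; rewrite gt_eqF.
  by rewrite mulr_ge0 ?sqr_ge0// invr_ge0; lra.
rewrite ge0_integralD//; last 3 first.
- by move=> x _; rewrite lee_fin; lra.
- by move=> x _; rewrite -EFinM lee_fin mulr_ge0 ?sqr_ge0// invr_ge0; lra.
- by apply: emeasurable_funM => //; apply/measurable_EFinP; exact: measurable_funX.
rewrite integral_cst// [X in (_ * X)%E](probability_setT P) mule1 EFinD leeD2l//.
rewrite ge0_integralZl//; last 3 first.
- by apply/measurable_EFinP; exact: measurable_funX.
- by move=> x _; rewrite lee_fin sqr_ge0.
- by rewrite lee_fin invr_ge0; lra.
apply: (@le_trans _ _ (((2 * e)^-1)%:E * ((m%:R * q)^-1)%:E)%E).
  by rewrite lee_wpmul2l ?integral_ratio_sqr// lee_fin invr_ge0; lra.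
by rewrite -EFinM lee_fin -invfM !mulrA.
Qed.

End weak_law.

(** * Functions of finitely many coordinates *)

Definition determined (U : Type) (N : nat) (f : binseq -> U) :=
  forall x y, (forall k, (k < N)%N -> x k = y k) -> f x = f y.

Definition word_cylinder (N : nat) (w : N.-tuple bool) : set binseq :=
  cylinder (iota 0 N) (fun k => [set nth false w k]).

Lemma word_cylinderP N (w : N.-tuple bool) (x : binseq) :
  word_cylinder w x <-> forall k, (k < N)%N -> x k = nth false w k.
Proof. by split=> h k kN; apply: h; move: kN; rewrite mem_iota. Qed.

Section determined_functions.
Context (R : realType).
Implicit Types (N : nat) (f : binseq -> R).

Lemma determinedW U N M (f : binseq -> U) :
  (N <= M)%N -> determined N f -> determined M f.
Proof. by move=> NM fN x y xy; apply: fN => k /leq_trans; move/(_ _ NM)/xy. Qed.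

(** Exactly one word cylinder contains [x], that of its prefix of length [N]. The sequence
    [nth false w], which pads [w] with [false], serves as a sample point of the cylinder of [w]. *)
Lemma determined_sum N f x : determined N f ->
  f x = \sum_(w : N.-tuple bool) f (nth false w) * \1_(word_cylinder w) x.
Proof.
move=> fN; rewrite (bigD1 [tuple x i | i < N])//= big1.
  have tx k : (k < N)%N -> nth false [tuple x i | i < N] k = x k.
    by move=> kN; rewrite (nth_mktuple _ _ (Ordinal kN)).
  rewrite addr0 indicE mem_set ?mulr1; first by apply: fN => k kN; rewrite tx.
  by apply/word_cylinderP => k kN; rewrite tx.
move=> w wx; rewrite indicE memNset ?mulr0// => /word_cylinderP xw.
move/eqP: wx; apply; apply: eq_from_tnth => i.
by rewrite tnth_mktuple xw// -tnth_nth.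
Qed.

Lemma measurable_determined N f : determined N f -> measurable_fun setT f.
Proof.
move=> fN; rewrite (_ : f = fun x => \sum_(w : N.-tuple bool)
    f (nth false w) * \1_(word_cylinder w) x); last first.
  by apply/funext => x; exact: determined_sum.
apply: measurable_sum => w; apply: measurable_funM => //.
by apply: measurable_indic; exact: measurable_cylinder.
Qed.

End determined_functions.

(** * The L^1 distance *)

Section L1_distance.
Context d (T : measurableType d) (R : realType) (nu : probability T R).
Implicit Types f g h : T -> R.

Definition L1dist f g : \bar R := (\int[nu]_x `|f x - g x|%:E)%E.

Lemma L1dist_triangle f g h : measurable_fun setT f -> measurable_fun setT g ->
  measurable_fun setT h -> (L1dist f h <= L1dist f g + L1dist g h)%E.
Proof.
move=> mf mg mh; rewrite /L1dist -ge0_integralD//; last 2 first.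
- by apply/measurable_EFinP/measurableT_comp => //; exact: measurable_funB.
- by apply/measurable_EFinP/measurableT_comp => //; exact: measurable_funB.
apply: ge0_le_integral => //.
- by apply/measurable_EFinP/measurableT_comp => //; exact: measurable_funB.
- apply: emeasurable_funD; apply/measurable_EFinP/measurableT_comp => //;
  exact: measurable_funB.
- by move=> x _; rewrite -EFinD lee_fin ler_distD.
Qed.

End L1_distance.

(** * Density in L^1 of the functions of finitely many coordinates *)

Section approximable.
Context (R : realType) (nu : probability binseq R).
Implicit Types f g h : binseq -> R.

Import HBSimple.

(** Membership in the L^1 closure of the functions of finitely many coordinates. *)
Definition approximable f := forall e : R, 0 < e ->
  exists N (phi : binseq -> R), determined N phi /\ (L1dist nu f phi <= e%:E)%E.

(** Applying a Lipschitz operation to approximants of [f] and [g], each within [e / (2 * K)], costs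
    at most [e]. This covers unions (maximum), complements (difference) and linear combinations at
    once. *)
Lemma approximable_lipschitz2 (op : R -> R -> R) (K : R) f g :
  0 < K -> (forall a b a' b', `|op a b - op a' b'| <= K * (`|a - a'| + `|b - b'|)) ->
  measurable_fun setT f -> measurable_fun setT g ->
  measurable_fun setT (fun x => op (f x) (g x)) ->
  approximable f -> approximable g -> approximable (fun x => op (f x) (g x)).
Proof.
move=> K0 lip mf mg mop af ag e e0.
have e'0 : 0 < e / (2 * K) by rewrite divr_gt0// mulr_gt0.
have [N1 [p1 [d1 l1]]] := af _ e'0; have [N2 [p2 [d2 l2]]] := ag _ e'0.
have D1 := determinedW (leq_maxl N1 N2) d1.
have D2 := determinedW (leq_maxr N1 N2) d2.
have Dop : determined (maxn N1 N2) (fun x => op (p1 x) (p2 x)).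
  by move=> x y xy; rewrite (D1 _ _ xy) (D2 _ _ xy).
exists (maxn N1 N2), (fun x => op (p1 x) (p2 x)); split => //.
have mp1 := measurable_determined d1; have mp2 := measurable_determined d2.
have mB (u v : binseq -> R) : measurable_fun setT u -> measurable_fun setT v ->
    measurable_fun setT (fun x => `|u x - v x|%:E).
  move=> mu mv; apply/measurable_EFinP/measurableT_comp => //.
    exact: measurable_funB.
apply: (@le_trans _ _ (K%:E * (L1dist nu f p1 + L1dist nu g p2))%E).
  rewrite /L1dist -ge0_integralD//; [|exact: mB..].
  have mD : measurable_fun setT (fun x => `|f x - p1 x|%:E + `|g x - p2 x|%:E)%E.
    by apply: emeasurable_funD; exact: mB.
  rewrite -ge0_integralZl//; last 2 first.
  - by move=> x _; rewrite -EFinD lee_fin addr_ge0.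
  - by rewrite lee_fin ltW.
  apply: ge0_le_integral => //.
  - by apply: mB => //; exact: measurable_determined Dop.
  - by exact: emeasurable_funM.
  - by move=> x _; rewrite -EFinD -EFinM lee_fin.
apply: (@le_trans _ _ (K%:E * ((e / (2 * K))%:E + (e / (2 * K))%:E))%E).
  by apply: lee_wpmul2l; [rewrite lee_fin ltW|exact: leeD].
rewrite -EFinD -EFinM (_ : K * _ = e)//.
by field; rewrite gt_eqF.
Qed.

Lemma approximable_limit f : measurable_fun setT f ->
  (forall e : R, 0 < e -> exists g, [/\ measurable_fun setT g, approximable g &
    (L1dist nu f g <= e%:E)%E]) ->
  approximable f.
Proof.
move=> mf fg e e0; have e2 : 0 < e / 2 by rewrite divr_gt0.
have [g [mg ag fge]] := fg _ e2; have [N [phi [dphi gphi]]] := ag _ e2.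
exists N, phi; split => //; apply: le_trans (L1dist_triangle nu mf mg _) _.
  exact: measurable_determined dphi.
by rewrite [e]splitr EFinD leeD.
Qed.

Lemma approximable_determined N f : determined N f -> approximable f.
Proof.
move=> fN e e0; exists N, f; split=> //.
rewrite /L1dist; under eq_integral do rewrite subrr normr0.
by rewrite integral0 lee_fin ltW.
Qed.

Lemma approximable_cst (r : R) : approximable (fun=> r).
Proof. exact: (@approximable_determined 0). Qed.

Let nbhs_ereal_lt0 (e : R) : 0 < e ->
  nbhs (0%E : \bar R) [set y | (y < e%:E)%E].
Proof.
move=> e0; apply: open_nbhs_nbhs; split; first exact: open_ereal_lt_ereal.
by rewrite /= lte_fin.
Qed.

Let max_lipschitz (a b a' b' : R) :
  `|Num.max a b - Num.max a' b'| <= `|a - a'| + `|b - b'|.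
Proof.
have := ler_norm (a - a'); have := ler_norm (b - b').
have := ler_norm (a' - a); have := ler_norm (b' - b).
rewrite (distrC a' a) (distrC b' b) ler_norml => h1 h2 h3 h4.
by case: (leP a b) => ab; case: (leP a' b') => ab'; apply/andP; split; lra.
Qed.

(** The measurable sets with approximable indicator form a sigma-algebra containing the coordinate
    events. *)
Lemma approximable_indic (A : set binseq) :
  measurable A -> approximable (\1_A : binseq -> R).
Proof.
move=> mA; suff [] : measurable A /\ approximable (\1_A : binseq -> R) by [].
pose C : set (set binseq) :=
  [set A | measurable A /\ approximable (\1_A : binseq -> R)].
have CU A1 A2 : C A1 -> C A2 -> C (A1 `|` A2).
  move=> [m1 a1] [m2 a2]; split; first exact: measurableU.
  have E : (\1_(A1 `|` A2) : binseq -> R) =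
      (fun x => Num.max (\1_A1 x) (\1_A2 x)).
    apply/funext => x; rewrite !indicE in_setU.
    by case: (x \in A1); case: (x \in A2); rewrite /Num.max /= ?ltxx ?ltr10 ?ltr01.
  rewrite E; apply: (@approximable_lipschitz2 (fun a b => Num.max a b) 1) => //.
  - by move=> a b a' b'; rewrite mul1r.
  by apply: measurable_maxr; exact: measurable_indic.
have C0 : C set0.
  by split=> //; rewrite indic0; exact: approximable_cst.
suff /(_ A mA) : measurable `<=` C by [].
apply: smallest_sub; last first.
  move=> _ [k _ [B mB <-]]; rewrite setTI; split.
    by rewrite -[X in measurable X]setTI; exact: measurable_coordinate.
  apply: (@approximable_determined k.+1) => x y xy.
  have Exy : B (x k) = B (y k) by rewrite xy.
  rewrite !indicE; congr (nat_of_bool _)%:R.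
  by apply/idP/idP => /set_mem Bx; apply/mem_set; move: Bx; rewrite /= Exy.
split => //.
  move=> B [mB aB]; split; first exact: measurableD.
  rewrite (_ : \1_(setT `\` B) = fun x => 1 - \1_B x); last first.
    apply/funext => x; rewrite setTD !indicE in_setC.
    by case: (x \in B); rewrite /= ?subrr ?subr0.
  apply: (@approximable_lipschitz2 (fun a b => a - b) 1 (fun=> 1)) => //.
  - by move=> a b a' b'; rewrite mul1r opprD addrACA -opprD ler_normB.
  - by apply: measurable_funB => //; exact: measurable_indic.
  - exact: approximable_cst.
move=> B0 CB; pose B : (set binseq)^nat := B0; rewrite -/B in CB *.
(* Countable unions: the finite unions [F n] are in the class, and what they miss decreases to the
   empty set, so its measure tends to 0. *)
pose F n : set binseq := \big[setU/set0]_(i < n) B i.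
have CF n : C (F n).
  rewrite /F; elim: n => [|n IH]; first by rewrite big_ord0.
  by rewrite big_ord_recr; exact: CU.
have mU : measurable (\bigcup_k B k : set binseq).
  by apply: bigcupT_measurable => k; case: (CB k).
have mF n : measurable (F n : set binseq) by case: (CF n).
split => //; apply: approximable_limit; first exact: measurable_indic.
move=> e e0.
have FE n : F n = \bigcup_(i < n) B i by rewrite /F bigcup_mkord.
have FU n : F n `<=` \bigcup_k B k by rewrite FE => x [k _ Bkx]; exists k.
have mD n : measurable (\bigcup_k B k `\` F n : set binseq) by exact: measurableD.
have cv : nu (\bigcup_k B k `\` F n) @[n --> \oo] --> (0 : \bar R)%E.
  have <- : nu (\bigcap_n (\bigcup_k B k `\` F n)) = 0%E.
    rewrite (_ : \bigcap_n _ = set0) ?measure0// -subset0 => x xh.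
    have [[k _ Bkx] _] := xh 0%N I.
    by have [_] := xh k.+1 I; apply; rewrite FE; exists k => /=.
  apply: (@nonincreasing_cvg_mu _ _ _ nu) => //.
  - by rewrite ltey_eq fin_num_measure.
  - by apply: bigcap_measurable.
  - move=> n m nm; apply/subsetPset; apply: setDS.
    by rewrite !FE => x [k kn Bkx]; exists k => //=; exact: leq_trans nm.
have [n _ /(_ n (leqnn _)) /= lt_e] := cv _ (nbhs_ereal_lt0 e0).
exists (\1_(F n)); split; [exact: measurable_indic|by case: (CF n)|].
(* As [F n] lies inside the union, the distance of the indicators is the measure of the
   difference. *)
rewrite /L1dist (_ : (fun x => _) =
    (fun x => (\1_(\bigcup_k B k `\` F n) x)%:E)); last first.
  apply/funext => x; congr EFin; rewrite !indicE in_setD.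
  case: (boolP (x \in F n)) => [/set_mem/FU xU|_].
    by rewrite mem_set//= subrr normr0.
  by rewrite subr0 andbT; case: (_ \in _); rewrite ?normr1 ?normr0.
by rewrite integral_indic// setIT ltW.
Qed.

Lemma approximable_integrable f :
  nu.-integrable setT (EFin \o f) -> approximable f.
Proof.
move=> fi; have mf : measurable_fun setT f.
  by apply/measurable_EFinP; exact: measurable_int fi.
apply: approximable_limit => // e e0.
have [g [_ _ cvg0]] := approximation_sfun_integrable measurableT fi.
have [n _ /(_ n (leqnn _)) /= lt_e] := cvg0 _ (nbhs_ereal_lt0 e0).
exists (g n); split => //; last exact: ltW.
(* A simple function is a finite combination of indicators of its level sets; the induction runs
   over the list of its values. *)
have [s ->] : exists s : seq R, (g n : binseq -> R) =
    fun x => \sum_(y <- s) y * \1_(g n @^-1` [set y]) x.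
  exists (finmap.enum_fset (fset_set (range (g n)))).
  by apply/funext => x; rewrite [LHS]fimfunE fsbig_finite.
elim: s => [|y s IH].
  rewrite (_ : (fun x => _) = fun=> 0); first exact: approximable_cst.
  by apply/funext => x; rewrite big_nil.
rewrite (_ : (fun x => _) = fun x => y * \1_(g n @^-1` [set y]) x +
    \sum_(z <- s) z * \1_(g n @^-1` [set z]) x); last first.
  by apply/funext => x; rewrite big_cons.
have mI z : measurable_fun setT (\1_(g n @^-1` [set z]) : binseq -> R).
  apply: measurable_indic; rewrite -[X in measurable X]setTI.
  exact: measurable_funP.
have mS : measurable_fun setT (fun x => \sum_(z <- s) z * \1_(g n @^-1` [set z]) x).
  by apply: measurable_sum => z; exact: measurable_funM.
apply: (@approximable_lipschitz2 (fun a b => y * a + b) (`|y| + 1)) => //.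
- move=> a b a' b'.
  have -> : y * a + b - (y * a' + b') = y * (a - a') + (b - b') by ring.
  apply: le_trans (ler_normD _ _) _; rewrite normrM.
  have := normr_ge0 (a - a'); have := normr_ge0 (b - b'); have := normr_ge0 y.
  by nra.
- by apply: measurable_funD => //; exact: measurable_funM.
- apply: approximable_indic; rewrite -[X in measurable X]setTI.
  exact: measurable_funP.
Qed.

(** Replacing the approximant by its positive part does not increase its distance to a nonnegative
    [f]. Nonnegativity is what later yields nonnegative coefficients. *)
Lemma approximable_ge0 f (e : R) : 0 < e -> (forall x, 0 <= f x) ->
  nu.-integrable setT (EFin \o f) ->
  exists N (phi : binseq -> R), [/\ forall x, 0 <= phi x, determined N phi &
    (L1dist nu f phi <= e%:E)%E].
Proof.
move=> e0 f0 fi; have mf : measurable_fun setT f.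
  by apply/measurable_EFinP; exact: measurable_int fi.
have [N [phi [dphi le_e]]] := approximable_integrable fi e0.
have dm : determined N (fun x => Num.max (phi x) 0) by move=> x y /dphi ->.
exists N, (fun x => Num.max (phi x) 0); split => //.
  by move=> x; rewrite le_max lexx orbT.
apply: le_trans le_e; apply: ge0_le_integral => //.
- apply/measurable_EFinP/measurableT_comp => //; apply: measurable_funB => //.
  exact: measurable_determined dm.
- apply/measurable_EFinP/measurableT_comp => //; apply: measurable_funB => //.
  exact: measurable_determined dphi.
- move=> x _; rewrite lee_fin -[X in X - _](max_idPl (f0 x)).
  by apply: le_trans (max_lipschitz _ _ _ _) _; rewrite subrr normr0 addr0.
Qed.

End approximable.

(** * The action on a product measure with identical factors of full support *)

Section product_measure_AT.
Context (R : realType) (mu : probability bool R) (nu : probability binseq R).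
Hypothesis hnu : is_product_probability (fun=> mu) nu.
Hypothesis mu_gt0 : forall b, (0 < mu [set b])%E.

Lemma natural_action_nonsingular : nonsingular_action nu natural_action.
Proof.
split=> // g; apply/null_content_dominatesP => A mA.
  by move=> nuA; rewrite (distribution_permute hnu).
by move=> nuA; rewrite -(distribution_permute hnu g).
Qed.

Lemma transfer_natural_action (g : finperm) (f : binseq -> R) :
  {ae nu, forall y, transfer nu natural_action g f y = (f (permute g^-1%g y))%:E}.
Proof.
have := @Radon_Nikodym_eq1 _ _ _ nu (distribution nu (natural_action g)).
move=> /(_ (distribution_permute hnu g)); apply: filterS => y /(_ I) E.
by rewrite /transfer E mule1.
Qed.

(** * Words, complementary blocks and averages over blocks *)

Section words.
Variable N : nat.
Implicit Types w : N.-tuple bool.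

(** Block 0 is reserved for [w] itself, hence the shift [l.+1]; [k %% N] is the position of [k]
    inside its block. *)
Definition coword_block w l : set binseq :=
  cylinder (iota (N * l.+1) N) (fun k => [set ~~ nth false w (k %% N)]).

Definition coword_mass w : R :=
  \prod_(i <- iota 0 N) fine (mu [set ~~ nth false w i]).

Lemma coword_mass_gt0 w : 0 < coword_mass w.
Proof.
apply: prodr_gt0 => i _; rewrite fine_gt0// mu_gt0/=.
by rewrite ltey_eq fin_num_measure.
Qed.

Let prod_block w l :
  (\prod_(k <- iota (N * l.+1) N) mu [set ~~ nth false w (k %% N)])%E =
  (coword_mass w)%:E.
Proof.
rewrite -[(N * l.+1)%N]addn0 iotaDl big_map (big_morph EFin (@EFinM R) erefl).
apply: eq_big_seq => i; rewrite mem_iota add0n => /andP[_ iN].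
by rewrite mulnC modnMDl modn_small// fineK// fin_num_measure.
Qed.

Lemma coword_block_prob w l : nu (coword_block w l) = (coword_mass w)%:E.
Proof. by rewrite (cylinder_prob _ hnu) ?iota_uniq//; exact: prod_block. Qed.

(** Distinct blocks share no coordinate, so the probability of the joint cylinder factors. *)
Lemma coword_block_indep w l l' : l != l' ->
  nu (coword_block w l `&` coword_block w l') =
  (coword_mass w * coword_mass w)%:E.
Proof.
move=> ll'; rewrite /coword_block -cylinder_cat (cylinder_prob _ hnu).
  rewrite big_cat EFinM; congr (_ * _)%E; exact: prod_block.
rewrite cat_uniq !iota_uniq andbT/=; apply/hasPn => k; rewrite !mem_iota.
have lt_blocks a b : (a < b)%N -> (N * a.+1 + N <= N * b.+1)%N.
  by move=> ab; rewrite -mulnSr leq_mul2l ltnS ab orbT.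
by move: ll'; case: (ltngtP l l') => // /lt_blocks; lia.
Qed.

Definition base_cylinder : set binseq :=
  cylinder (iota 0 (N + N)) (fun k => [set (N <= k)%N]).

(* The witness sends the positions k and N + k to k and its mate N(l+1) + k,
   in one order or the other according to the k-th letter of w. *)
Lemma word_permutation w l : exists s : finperm,
  permute s @^-1` base_cylinder = word_cylinder w `&` coword_block w l.
Proof.
pose i' k := if (k < N)%N then k else (k - N)%N.
(* The value wanted at [k] is the negation of [k < N]. If the letter equals [k < N], this is the
   complemented letter, found in the far block; otherwise it is the letter itself, found in block
   0. *)
pose h k := if nth false w (i' k) == (k < N)%N then (N * l.+1 + i' k)%N else i' k.
have [s sh] : exists s : finperm, forall k, (k < N + N)%N -> s k = h k.
  apply: finperm_extension => j k; rewrite !inE /h => jN kN.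
  have MN : (N <= N * l.+1)%N by rewrite leq_pmulr.
  have i'N a : (a < N + N)%N -> (i' a < N)%N by rewrite /i'; case: (ltnP a N); lia.
  move: (i'N _ jN) (i'N _ kN).
  have inj : i' j = i' k -> (j < N)%N = (k < N)%N -> j = k.
    by rewrite /i'; case: (ltnP j N); case: (ltnP k N) => //; lia.
  (* Equal images lie in the same block, which gives equal [i']; the letter then forces [j] and [k]
     into the same half. *)
  case: eqP => ej; case: eqP => ek => ji ki E.
  - have E' : i' j = i' k by lia.
    by apply: inj => //; rewrite -ej -ek E'.
  - by lia.
  - by lia.
  - apply: inj => //; move: ej ek; rewrite E.
    by case: (nth _ _ _); case: (j < N)%N; case: (k < N)%N.
exists s; apply/seteqP; split => x.
  move=> xs; have xh k : (k < N + N)%N -> x (h k) = (N <= k)%N.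
    by move=> kN; rewrite -sh//; apply: xs; rewrite mem_iota.
  have N_le i : (N + i < N)%N = false by lia.
  split.
    (* Position [k] of block 0 is reached from [N + k] if the letter is [true], and from [k]
       otherwise; in the far block it is the other way round. *)
    apply/word_cylinderP => k kN; case E : (nth false w k).
      have := xh (N + k)%N; rewrite /h /i' N_le addKn E/= leq_addr.
      by apply; lia.
    have := xh k; rewrite /h /i' kN E/= => ->; last by lia.
    by rewrite leqNgt kN.
  move=> k; rewrite mem_iota /= => kN; pose i := (k - N * l.+1)%N.
  have iN : (i < N)%N by rewrite /i; lia.
  have -> : k = (N * l.+1 + i)%N by rewrite /i; lia.
  rewrite mulnC modnMDl modn_small// mulnC; case E : (nth false w i).
    have := xh i; rewrite /h /i' iN E/= => ->; last by lia.
    by rewrite leqNgt iN.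
  have := xh (N + i)%N; rewrite /h /i' N_le addKn E/= leq_addr.
  by apply; lia.
move=> [/word_cylinderP xw xc] k; rewrite mem_iota/= add0n => kN.
have xc' i : (i < N)%N -> x (N * l.+1 + i)%N = ~~ nth false w i.
  move=> iN; have := xc (N * l.+1 + i)%N; rewrite mem_iota /= mulnC modnMDl.
  by rewrite modn_small//; apply; lia.
rewrite /permute/= sh// /h /i'; case: (ltnP k N) => kN'.
  by case E : (nth false w k); rewrite /= ?xc' ?xw// E.
case E : (nth false w (k - N)) => /=; first by rewrite xw ?E//; lia.
by rewrite xc' ?E//; lia.
Qed.

Definition block_average (m : nat) (phi : binseq -> R) (x : binseq) : R :=
  \sum_(w : N.-tuple bool) \sum_(l < m)
    phi (nth false w) / (m%:R * coword_mass w) *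
    (\1_(word_cylinder w) x * \1_(coword_block w l) x).

(** On the cylinder of [w] the difference is [phi (nth false w)] times the deviation from 1 of the
    normalised block frequency. Bounding the indicator of the cylinder by 1 leaves one instance of
    the weak law per word. *)
Lemma L1dist_block_average m (phi : binseq -> R) (e : R) : (0 < m)%N -> 0 < e ->
  (forall x, 0 <= phi x) -> determined N phi ->
  (L1dist nu phi (block_average m phi) <=
   (\sum_(w : N.-tuple bool) phi (nth false w) *
      (e / 2 + (2 * e * m%:R * coword_mass w)^-1))%:E)%E.
Proof.
move=> m0 e0 phi0 dphi.
have mC w l : measurable (coword_block w l) by exact: measurable_cylinder.
have mW w : measurable (word_cylinder w) by exact: measurable_cylinder.
pose S w x : R := (m%:R * coword_mass w)^-1 * \sum_(l < m) \1_(coword_block w l) x.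
have avgE x : block_average m phi x =
    \sum_(w : N.-tuple bool) phi (nth false w) * (\1_(word_cylinder w) x * S w x).
  apply: eq_bigr => w _; rewrite /S !mulr_sumr; apply: eq_bigr => l _.
  by ring.
have mS w : measurable_fun setT (S w).
  apply: measurable_funM => //; apply: measurable_sum => l.
  exact: measurable_indic.
have mavg : measurable_fun setT (block_average m phi).
  rewrite (funext avgE).
  apply: measurable_sum => w; apply: measurable_funM => //.
  by apply: measurable_funM => //; exact: measurable_indic.
have mabs w : measurable_fun setT (fun x => `|1 - S w x|%:E).
  by apply/measurable_EFinP/measurableT_comp => //; exact: measurable_funB.
have mterm w : measurable_fun setT
    (fun x => (phi (nth false w))%:E * `|1 - S w x|%:E)%E.
  exact: emeasurable_funM.
apply: (@le_trans _ _ (\int[nu]_x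
    (\sum_(w : N.-tuple bool) (phi (nth false w))%:E * `|1 - S w x|%:E)))%E.
  apply: ge0_le_integral => //.
  - apply/measurable_EFinP/measurableT_comp => //; apply: measurable_funB => //.
    exact: measurable_determined dphi.
  - by apply: emeasurable_sum.
  move=> x _; under eq_bigr do rewrite -EFinM.
  rewrite sumEFin lee_fin avgE (determined_sum x dphi) -sumrB.
  apply: le_trans (ler_norm_sum _ _ _) _; apply: ler_sum => w _.
  rewrite -mulrBr normrM ger0_norm// ler_wpM2l//.
  rewrite -{1}[\1_(word_cylinder w) x]mulr1 -mulrBr normrM ler_piMl//.
  by rewrite indicE; case: (_ \in _); rewrite /= ?normr1 ?normr0.
rewrite ge0_integral_sum//; last first.
  by move=> w x _; rewrite -EFinM lee_fin mulr_ge0.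
rewrite -sumEFin; apply: lee_sum => w _.
rewrite ge0_integralZl//; last by rewrite lee_fin.
rewrite EFinM; apply: lee_wpmul2l; first by rewrite lee_fin.
apply: (weak_law_L1 (Y := coword_block w)) => //.
- exact: coword_mass_gt0.
- exact: coword_block_prob.
- by move=> l l'; exact: coword_block_indep.
Qed.

End words.

Lemma natural_action_approximately_transitive :
  approximately_transitive nu natural_action.
Proof.
split=> [|n f_ eps f_L1 eps0]; first exact: natural_action_nonsingular.
have eps2 : 0 < eps / 2 by rewrite divr_gt0.
have /choice[N_ /choice[phi_ phiP]] j :=
  approximable_ge0 eps2 (f_L1 j).1 (f_L1 j).2.
pose N := (\max_(j < n) N_ j)%N.
have phi0 j : forall x, 0 <= phi_ j x by case: (phiP j).
have dphi j : determined N (phi_ j).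
  by case: (phiP j) => _ d _; apply: determinedW d; exact: leq_bigmax.
(* [C] and [D] bound, for all [j] at once, the sums multiplying [e / 2] and [(2 * e * m%:R)^-1] in
   the error estimate. *)
pose C := \sum_(j < n) \sum_(w : N.-tuple bool) phi_ j (nth false w).
pose D := \sum_(j < n) \sum_(w : N.-tuple bool) phi_ j (nth false w) / coword_mass w.
have C0 : 0 <= C by apply: sumr_ge0 => j _; exact: sumr_ge0.
have D0 : 0 <= D.
  apply: sumr_ge0 => j _; apply: sumr_ge0 => w _.
  by rewrite divr_ge0// ltW// coword_mass_gt0.
have [e e0 eC] : exists2 e : R, 0 < e & C * (e / 2) <= eps / 4.
  (* The summand 1 keeps the denominator positive when [C] is 0. *)
  exists (eps / (2 * (C + 1))); first by rewrite divr_gt0//; lra.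
  rewrite (_ : _ * _ = eps / 4 * (C / (C + 1))); last by field; lra.
  by rewrite ler_piMr//; [lra|rewrite ler_pdivrMr; lra].
(* Chosen so that [D / (2 * e * m)] is at most [eps / 4]; the successor makes [m] positive. *)
pose m := (Num.bound (2 * D / (e * eps))).+1.
have mR0 : 0 < m%:R :> R by rewrite ltr0n.
have mD : 2 * D <= m%:R * (e * eps).
  have q0 : 0 <= 2 * D / (e * eps) by apply: divr_ge0; apply: mulr_ge0; rewrite // ltW.
  rewrite -ler_pdivrMr ?mulr_gt0//; apply: le_trans (ltW (archi_boundP q0)) _.
  by rewrite ler_nat.
have avg_close j :
    (L1dist nu (phi_ j) (block_average N m (phi_ j)) <= (eps / 2)%:E)%E.
  apply: le_trans (L1dist_block_average (ltn0Sn _) e0 (phi0 j) (dphi j)) _.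
  rewrite lee_fin.
  under eq_bigr do rewrite mulrDr.
  rewrite big_split/= -mulr_suml.
  rewrite [X in _ + X](eq_bigr (fun w : N.-tuple bool =>
    phi_ j (nth false w) / coword_mass w * (2 * e * m%:R)^-1)); last first.
    by move=> w _; rewrite [in LHS]invfM mulrA mulrAC.
  rewrite -mulr_suml.
  have leC : \sum_(w : N.-tuple bool) phi_ j (nth false w) <= C.
    by rewrite /C (bigD1 j)//= lerDl sumr_ge0// => i _; exact: sumr_ge0.
  have leD : \sum_(w : N.-tuple bool) phi_ j (nth false w) / coword_mass w <= D.
    rewrite /D (bigD1 j)//= lerDl sumr_ge0// => i _; apply: sumr_ge0 => w _.
    by rewrite divr_ge0// ltW// coword_mass_gt0.
  rewrite [eps / 2](_ : _ = eps / 4 + eps / 4); last by field.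
  apply: lerD.
    by apply: le_trans eC; rewrite ler_wpM2r//; lra.
  apply: (@le_trans _ _ (D * (2 * e * m%:R)^-1)).
    by rewrite ler_wpM2r// invr_ge0 !mulr_ge0// ltW.
  by rewrite ler_pdivrMr ?mulr_gt0//; nra.
have /choice[s_ sP] (wl : N.-tuple bool * 'I_m) := word_permutation wl.1 wl.2.
pose I := (N.-tuple bool * 'I_m)%type.
pose f : binseq -> R := \1_(base_cylinder N).
have mf : measurable_fun setT f.
  by apply: measurable_indic; exact: measurable_cylinder.
(* The translates are indexed by pairs of a word and a block. The inverse compensates the one in
   [transfer], so that [f] is composed with [permute (s_ _)]. *)
pose g (k : 'I_#|{: I}|) : finperm := (s_ (enum_val k))^-1%g.
pose lam j (k : 'I_#|{: I}|) : R :=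
  phi_ j (nth false (enum_val k).1) / (m%:R * coword_mass (enum_val k).1).
exists f, #|{: I}|, g, lam; split.
- split; first by move=> y; rewrite /f indicE.
  by apply: integrable_indic => //; exact: measurable_cylinder.
- by move=> j k; rewrite divr_ge0// mulr_ge0// ltW// coword_mass_gt0.
move=> j.
have fj_m : measurable_fun setT (f_ j).
  by apply/measurable_EFinP; exact: measurable_int (f_L1 j).2.
have mavg : measurable_fun setT (block_average N m (phi_ j)).
  apply: measurable_sum => w; apply: measurable_sum => l.
  apply: measurable_funM => //; apply: measurable_funM;
  by apply: measurable_indic; exact: measurable_cylinder.
have -> : ('N[nu]_1[(fun y => (f_ j y)%:E -
    \sum_(k < #|{: I}|) (lam j k)%:E * transfer nu natural_action (g k) f y)] =
    L1dist nu (f_ j) (block_average N m (phi_ j)))%E.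
  rewrite Lnorm1; apply: ae_eq_integral => //.
  - apply: measurableT_comp => //; apply: emeasurable_funB.
      exact/measurable_EFinP.
    apply: emeasurable_sum => k; apply: emeasurable_funM => //.
    apply: emeasurable_funM.
      apply/measurable_EFinP.
      exact: (measurableT_comp mf (measurable_permute (g k)^-1%g)).
    apply: (measurable_int nu); apply: Radon_Nikodym_integrable.
    by have [_ _ + _] := natural_action_nonsingular; exact.
  - by apply/measurable_EFinP/measurableT_comp => //; exact: measurable_funB.
  (* The derivative is known only almost everywhere; finitely many exceptional null sets are
     discarded together. *)
  have : {ae nu, forall y, forall k : 'I_#|{: I}|,
      transfer nu natural_action (g k) f y = (f (permute (g k)^-1%g y))%:E}.
    by apply: filter_forall => k; exact: transfer_natural_action.
  apply: filterS => y yE _; under eq_bigr do rewrite yE -EFinM.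
  rewrite sumEFin -EFinB abse_EFin; congr (`|_ - _|%:E).
  rewrite /block_average pair_big/=.
  rewrite [RHS](reindex (@enum_val I {: I}))/=; last first.
    by exists enum_rank => k _; [exact: enum_valK|exact: enum_rankK].
  apply: eq_bigr => k _; congr (_ * _); rewrite /g invgK /f.
  rewrite -[LHS]/(\1_(permute (s_ (enum_val k)) @^-1` base_cylinder N) y).
  by rewrite sP indicI.
apply: le_trans (L1dist_triangle nu fj_m (measurable_determined (dphi j)) mavg) _.
by rewrite [eps]splitr EFinD leeD//; case: (phiP j).
Qed.

End product_measure_AT.

Theorem theorem2p1 (R : realType) (lambda : R) (hlambda : 0 < lambda <= 1)
    (nu : probability binseq R) (hnu : is_bernoulli_measure lambda nu) :
  approximately_transitive nu natural_action.
Proof.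
have /andP[lambda0 _] := hlambda.
apply: natural_action_approximately_transitive hnu _ => -[].
  rewrite [ltRHS](bernoulli_factor_true lambda0) lte_fin.
  by have /andP[] := bernoulli_factor_bounds lambda0.
by rewrite [ltRHS](bernoulli_factor_false lambda0) lte_fin divr_gt0// addr_gt0.
Qed.
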